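(* Let $N\ge 2$ be an integer and let a class II system of graphs be given (see context), with vertex set $\nu$, $|\nu|=n$, adjacency matrices $G_1,\dots,G_{N-1}$, integer $h>N$, and set of exponents with multiplicity $\mathrm{Exp}$. Let $g$ be the associated intersection form, i.e. the bilinear form with matrix $g_{ab}=2\delta_{ab}+\sum_{p=1}^{N-1}(G_p)_{ab}$ $(a,b\in\nu)$. Then the signature of $g$ is $(x+,y-,z0)$ (that is, the real symmetric matrix $(g_{ab})$ has $x$ positive, $y$ negative and $z$ zero eigenvalues, counted with multiplicity), where, counting over all $(\lambda,i)\in \mathrm{Exp}$ (so that there are $n$ numbers $q^{(R)}_\lambda$ in total): - $x$ is the number of $q^{(R)}_\lambda$ which lie in an open interval $\left]2p-\tfrac12,\,2p+\tfrac12\right[$ for some $p\in\mathbb Z$ ($p$ may depend on $q^{(R)}_\lambda$); - $y$ is the number of $q^{(R)}_\lambda$ which lie in an open interval $\left]2p'+\tfrac12,\,2p'+\tfrac32\right[$ for some $p'\in\mathbb Z$ ($p'$ may depend on $q^{(R)}_\lambda$); - $z=n-x-y$ is the number of $q^{(R)}_\lambda$ which are half-integers, i.e. lie in $\mathbb Z+\tfrac12$.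
   Context: Weights. Let $\Lambda_1,\dots,\Lambda_{N-1}$ be the fundamental weights of $SL(N)$, and let $e_1=\Lambda_1$, $e_i=\Lambda_i-\Lambda_{i-1}$ for $i=2,\dots,N-1$, $e_N=-\Lambda_{N-1}$ be the weights of the standard $N$-dimensional representation, with scalar product $(e_i,e_j)=\delta_{ij}-\frac1N$. For an integer $h>N$ put $$P_{++}^{(h)}=\{\lambda=\lambda_1\Lambda_1+\dots+\lambda_{N-1}\Lambda_{N-1}\;:\;\lambda_i \text{ positive integers},\ \lambda_1+\dots+\lambda_{N-1}<h\}.$$ Class II graphs. A class II system of graphs consists of the following data satisfying the following axioms. (1) A finite set $\nu$ of $|\nu|=n$ vertices, with an involution $a\mapsto\bar a$ and a $\mathbb Z_N$-grading $\tau:\nu\to\mathbb Z/N\mathbb{Z}$ such that $\tau(\bar a)=-\tau(a)$ mod $N$. (2) $N-1$ pairwise commuting $n\times n$ matrices $G_1,\dots,G_{N-1}$, indexed by $\nu$, with non-negative integer entries; they are regarded as adjacency matrices of $N-1$ graphs, and the graph with adjacency matrix $G_1$ is connected. (3) $(G_p)_{ab}=0$ if $\tau(b)\ne\tau(a)+p$ mod $N$. (4) $G_p^{t}=G_{N-p}$ and $(G_p)_{ab}=(G_p)_{\bar b\bar a}$. (5) The $G_p$, which by (2) and (4) are commuting normal matrices, are simultaneously diagonalized in an orthonormal basis $\psi^{(\lambda,i)}$ labelled by weights $\lambda\in P_{++}^{(h)}$ for some integer $h>N$, together with an index $1\le i\le m_\lambda$, in such a way that the eigenvalue of $G_p$ on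 $\psi^{(\lambda,i)}$ is $\gamma_p^{(\lambda)}=\chi_p(M(\lambda))$. Here $\chi_p$ is the ordinary character of the $p$-th fundamental representation of $SU(N)$ (the $p$-th exterior power of the standard representation), $M(\lambda)=\mathrm{diag}(\epsilon_j(\lambda))_{j=1,\dots,N}$ with $\epsilon_j(\lambda)=\exp\left(-\frac{2\pi \sqrt{-1}}{h}(e_j,\lambda)\right)$, and $m_\lambda$ is the multiplicity of the system of eigenvalues $(\gamma_p^{(\lambda)})_{p}$. The set of all labels $(\lambda,i)$ that occur is denoted $\mathrm{Exp}$; it has $n$ elements. The numbers $q^{(R)}_\lambda$. For $(\lambda,i)\in\mathrm{Exp}$ with $\lambda=\sum_j\lambda_j\Lambda_j$, put $$q^{(R)}_\lambda:=\frac1h\sum_{j=1}^{N-1}j(\lambda_j-1)+\frac{(N-h)(N-1)}{2h},$$ which depends only on $\lambda$. *)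

(* Defs.v *)
(* Reals: an arbitrary realType R; complex numbers: R[i]. *)
From HB Require Import structures.
From mathcomp Require Import all_boot all_order all_algebra.
From mathcomp Require Import boolp reals trigo.
From mathcomp Require Import complex.

Set Implicit Arguments.
Unset Strict Implicit.
Unset Printing Implicit Defensive.

Import Order.TTheory GRing.Theory Num.Theory.
Local Open Scope ring_scope.

(* [std_weight i] is e_(i+1), realised as the projection of the standard basis
   vector of R^N on the hyperplane of vectors with zero coordinate sum; the
   scalar product is the standard one (see [wdot_std_weight]).  [fund_weight k]
   is Lambda_(k+1) = e_1 + ... + e_(k+1). *)
Definition std_weight (R : realType) (N : nat) (i : 'I_N) : 'rV[R]_N :=
  delta_mx 0 i - const_mx (N%:R^-1).

Definition wdot (R : realType) (N : nat) (u v : 'rV[R]_N) : R :=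
  (u *m v^T) 0 0.

Definition fund_weight (R : realType) (N : nat) (k : 'I_N.-1) : 'rV[R]_N :=
  \sum_(i < N | (i <= k)%N) std_weight R i.

(* [lam k] is the Dynkin label lambda_(k+1).  Weights of the alcove P_++^(h)
   have all labels < h, so labels in 'I_h lose nothing. *)
Definition labels (N h : nat) := {ffun 'I_N.-1 -> 'I_h}.

Definition in_alcove (N h : nat) : pred (labels N h) :=
  fun lam => [forall k, (0 < lam k)%N] && (\sum_k lam k < h)%N.

Definition alcove (N h : nat) := {lam : labels N h | in_alcove lam}.

Definition weight_vec (R : realType) (N h : nat) (lam : labels N h) : 'rV[R]_N :=
  \sum_k (lam k)%:R *: fund_weight R k.

Definition cexpi (R : realType) (t : R) : R[i] := (cos t +i* sin t)%C.

Definition epsilon (R : realType) (N h : nat) (lam : labels N h) (j : 'I_N)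
    : R[i] :=
  cexpi (- (2 * pi / h%:R) * wdot (std_weight R j) (weight_vec R lam)).

Definition Mlam (R : realType) (N h : nat) (lam : labels N h) : 'M[R[i]]_N :=
  diag_mx (\row_j epsilon R lam j).

(* Matrix of the p-th exterior power of M in the basis of the wedges
   e_(i_1) /\ ... /\ e_(i_p), i_1 < ... < i_p, indexed by the p-subsets of 'I_N;
   its entries are the p x p minors of M. *)
Definition psubset (N p : nat) := {I : {set 'I_N} | #|I| == p}.

Definition psubset_nth (N p : nat) (I : psubset N p) (i : 'I_p) : 'I_N :=
  enum_val (cast_ord (esym (eqP (valP I))) i).

Definition ext_power (K : comPzRingType) (N p : nat) (M : 'M[K]_N)
    : 'M[K]_#|{: psubset N p}| :=
  \matrix_(I, J) \det (mxsub (psubset_nth (enum_val I))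
                             (psubset_nth (enum_val J)) M).

Definition chi (K : comPzRingType) (N p : nat) (M : 'M[K]_N) : K :=
  \tr (ext_power p M).

Definition gamma (R : realType) (N h p : nat) (lam : labels N h) : R[i] :=
  chi p (Mlam R lam).

Definition adj_mx (K : pzSemiRingType) (n : nat) (A : 'M[nat]_n) : 'M[K]_n :=
  map_mx (fun k : nat => k%:R) A.

(* Multiplicity m_lambda: dimension of the joint eigenspace.  [eigenspace] is
   about row vectors, hence the transposes. *)
Definition eig_mult (R : realType) (N n h : nat) (G : nat -> 'M[nat]_n)
    (lam : labels N h) : nat :=
  \rank (\bigcap_(1 <= p < N)
           eigenspace (adj_mx R[i] (G p))^T (gamma R p lam))%MS.

(* The pairs (lambda, i) with lambda in P_++^(h) and i ranging over a set of
   m_lambda elements (i = 0, ..., m_lambda - 1). *)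
Definition exponents (R : realType) (N n h : nat) (G : nat -> 'M[nat]_n) :=
  {lam : alcove N h & 'I_(eig_mult R G (val lam))}.

Definition exp_weight (R : realType) (N n h : nat) (G : nat -> 'M[nat]_n)
    (e : exponents R N h G) : labels N h := val (tag e).

(* Connectedness of the graph underlying the (possibly directed) graph with
   adjacency matrix A. *)
Definition graph_connected (n : nat) (A : 'M[nat]_n) : Prop :=
  forall a b : 'I_n,
    connect [rel x y | (0 < A x y)%N || (0 < A y x)%N] a b.

(* The vertex set is 'I_n and [altitude] is the integer h.  Only the matrices gadj p = G_p with 0 < p < N are
   meaningful.  'Z_N is Z/NZ only for N >= 2. *)
Record class_II (R : realType) (N n : nat) := ClassII {
  vbar : 'I_n -> 'I_n;
  vtau : 'I_n -> 'Z_N;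
  gadj : nat -> 'M[nat]_n;
  altitude : nat;
  vbarK : involutive vbar;
  vtau_bar : forall a, vtau (vbar a) = - vtau a;
  gadj_comm : forall p q, (0 < p < N)%N -> (0 < q < N)%N ->
    gadj p *m gadj q = gadj q *m gadj p;
  gadj1_connected : graph_connected (gadj 1);
  gadj_grading : forall p a b, (0 < p < N)%N ->
    vtau b <> vtau a + p%:R -> gadj p a b = 0%N;
  gadj_tr : forall p, (0 < p < N)%N -> (gadj p)^T = gadj (N - p);
  gadj_bar : forall p a b, (0 < p < N)%N ->
    gadj p a b = gadj p (vbar b) (vbar a);
  ltN_altitude : (N < altitude)%N;
  psi : exponents R N altitude gadj -> 'cV[R[i]]_n;
  psi_basis : basis_of fullv (codom psi);
  psi_orthonormal : forall e f,
    \sum_a (psi e a 0)^* * psi f a 0 = (e == f)%:R;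
  psi_eigen : forall p e, (0 < p < N)%N ->
    adj_mx R[i] (gadj p) *m psi e = gamma R p (exp_weight e) *: psi e
}.

Definition Exp (R : realType) (N n : nat) (S : class_II R N n) : finType :=
  exponents R N (altitude S) (gadj S).

Definition exp_labels (R : realType) (N n : nat) (S : class_II R N n)
  (e : Exp S) : labels N (altitude S) := exp_weight e.

(* In the sum, k : 'I_N.-1 stands for j = k + 1. *)
Definition qR (R : realType) (N h : nat) (lam : labels N h) : R :=
  h%:R^-1 * (\sum_(k < N.-1) k.+1%:R * ((lam k)%:R - 1))
  + (N%:R - h%:R) * (N%:R - 1) / (2 * h%:R).

Definition intersection_form (R : realType) (N n : nat) (S : class_II R N n)
    : 'M[R]_n :=
  \matrix_(a, b) (2 * (a == b)%:R + \sum_(1 <= p < N) (gadj S p a b)%:R).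

(* The sequence s lists the eigenvalues of A with multiplicity. *)
Definition has_signature (R : realType) (n : nat) (A : 'M[R]_n)
    (x y z : nat) : Prop :=
  exists s : seq R,
    [/\ char_poly A = \prod_(a <- s) ('X - a%:P),
        count (fun a => 0 < a) s = x,
        count (fun a => a < 0) s = y &
        count (fun a => a == 0) s = z].

Lemma wdot_std_weight (R : realType) (N : nat) (i j : 'I_N) :
  wdot (std_weight R i) (std_weight R j) = (i == j)%:R - N%:R^-1.
Proof.
have N0 : N%:R != 0 :> R by rewrite pnatr_eq0 -lt0n; case: N i j => [[]|].
rewrite /wdot /std_weight !mxE.
under eq_bigr => k _ do rewrite !mxE !eqxx /= mulrBl !mulrBr.
have E (a : 'I_N) : \sum_(k < N) (k == a)%:R = 1 :> R.
  by rewrite (bigD1 a) //= eqxx big1 ?addr0 // => k /negbTE ->.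
rewrite !sumrB -mulr_suml -mulr_sumr !E sumr_const card_ord.
rewrite -mulrnAl -(mulr_natr N%:R^-1 N) mulVf // mul1r mulr1 subrr subr0; congr (_ - _).
rewrite (bigD1 i) //= eqxx mul1r big1 ?addr0 //.
by move=> k /negbTE ->; rewrite mul0r.
Qed.

Lemma sum_std_weight (R : realType) (N : nat) :
  \sum_(i < N) std_weight R i = 0.
Proof.
apply/rowP=> j; rewrite summxE mxE.
under eq_bigr => i _ do rewrite !mxE eqxx /=.
have N0 : N%:R != 0 :> R by rewrite pnatr_eq0 -lt0n; case: N j => [[]|].
rewrite sumrB sumr_const card_ord -(mulr_natl N%:R^-1) mulfV //.
rewrite (bigD1 j) //= eqxx big1 ?addr0 ?subrr // => k.
by rewrite eq_sym => /negbTE ->.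
Qed.

(* Main.v *)
Require Import Defs.
From mathcomp Require Import all_boot all_order all_algebra.
From mathcomp Require Import boolp reals trigo complex.
From mathcomp Require Import zify ring lra.

Set Implicit Arguments.
Unset Strict Implicit.
Unset Printing Implicit Defensive.

Import Order.TTheory GRing.Theory Num.Theory.
Local Open Scope ring_scope.


(** An eigenvector of weight lam has eigenvalue 2 + sum_p gamma_p(lam) under
    the intersection form.  As chi_p(M) is the p-th elementary symmetric function
    of the eigenvalues eps_j of M, and chi_0 = chi_N = 1 on the special unitary
    group, this number is prod_j (1 + eps_j) = 2^N prod_j cos (pi x_j / h) with
    x_j = (e_j, lam) ([sum_gamma], [char_poly_intersection_form]).  Weight
    by weight, its sign does not match the class of q_lam: for N = 3, h = 20,
    lam = (8, 1) the three cosines are positive although q_lam = - 1/2 is a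
    half-integer.

    The two counts agree once they are summed over the orbits of the rotation of
    the alcove, which permutes cyclically lam_1, ..., lam_(N-1) and
    lam_0 = h - lam_1 - ... - lam_(N-1).  Rotation multiplies all eps_j by a
    fixed N-th root of unity w, hence gamma_p by w^p, and conjugation by
    diag (w^tau(a)) does the same to G_p because of the grading; so weights of one
    orbit have the same multiplicity ([eig_mult_rotate]), and it is enough to
    compare the two counts along the orbit of one weight ([orbit_balance]).

    One increasing sequence of integers V with V_(j+N) = V_j + H N, H = 2 h,
    describes a whole orbit ([level], [level_iter_rotate]).  For the k-th rotated
    weight and r = k + N - 1,
      q = V_r / H - r - N - 1/2,
      eigenvalue = (-2)^N prod_(j < N) sin (pi (V_(j+k) - k H) / (H N)),
    and the sign of this product is governed by the parity of k + a, where a is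
    the number of terms V_j below k H ([level_sine_prod_sign]).  Read the
    multiples k H and the values V_r in increasing order as a lattice path that
    goes up at k H, down at V_r, and stays level where the two coincide.
    Up to the parity of N, the sign of the eigenvalue attached to k is the parity
    of the height that the step up at k H reaches, and the class of q attached to r
    is the parity of the height that the step down at V_r leaves.  The path is
    periodic, so it reaches each height as often as it leaves it
    ([crossing_balance]).  Coincidences are the zero eigenvalues on one side and
    the half-integral q on the other. *)

(** * Two counts on a quasi-periodic sequence *)

Definition quasiperiodic (H N : nat) (V : nat -> nat) : Prop :=
  (forall j, V j < V j.+1)%N /\ (forall j, V (j + N) = V j + H * N)%N.

(** As V j >= j, the search below k * H always succeeds; its result is also the
    number of terms of V below k * H ([ltn_first_above]). *)
Definition first_above (H : nat) (V : nat -> nat) (k : nat) : nat :=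
  find (fun j => k * H <= V j)%N (iota 0 (k * H).+1).

Lemma quasiperiodic_lt (H N : nat) (V : nat -> nat) :
  quasiperiodic H N V -> {homo V : i j / (i < j)%N}.
Proof. by case=> Vinc _; apply: homo_ltn => // i j l; apply: ltn_trans. Qed.

Lemma ltn_first_above (H N : nat) (V : nat -> nat) k j :
  quasiperiodic H N V -> (j < first_above H V k)%N = (V j < k * H)%N.
Proof.
move=> qV; have Vlt := quasiperiodic_lt qV.
have Vge i : (i <= V i)%N.
  elim: i => // i IHi; apply: leq_ltn_trans IHi _; exact: Vlt.
have has_above : has (fun j => k * H <= V j)%N (iota 0 (k * H).+1).
  by apply/hasP; exists (k * H)%N; rewrite ?mem_iota ?add0n ?ltnS ?leqnn.
have small : (first_above H V k < (k * H).+1)%N.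
  by have := has_above; rewrite has_find size_iota.
apply/idP/idP => [jA|].
  have /negbT := before_find 0%N jA.
  by rewrite nth_iota ?add0n -?ltnNge //; lia.
apply: contraLR; rewrite -!leqNgt => Aj.
have := nth_find 0%N has_above.
rewrite -/(first_above H V k) nth_iota // add0n => /leq_trans; apply.
by move: Aj; rewrite leq_eqVlt => /predU1P[->//|/Vlt/ltnW].
Qed.

(** The bound on V 0 puts the whole first period V 0, ..., V (N - 1) below
    (k + N) * H; the terms after it are the shifted ones. *)
Lemma first_above_period (H N : nat) (V : nat -> nat) k :
  quasiperiodic H N V -> (V 0 < k * H)%N ->
  first_above H V (k + N) = (first_above H V k + N)%N.
Proof.
move=> qV V0; have [_ VN] := qV; have Vlt := quasiperiodic_lt qV.
have same j : (j < first_above H V (k + N))%N = (j < first_above H V k + N)%N.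
  rewrite (ltn_first_above _ _ qV); case: (ltnP j N) => [jN|Nj].
    by have := VN 0%N; have := Vlt _ _ jN; rewrite add0n; nia.
  by rewrite -(subnK Nj) VN ltn_add2r (ltn_first_above _ _ qV) mulnDl [(N * H)%N]mulnC ltn_add2r.
have := same (first_above H V (k + N)); have := same (first_above H V k + N)%N.
rewrite !ltnn; lia.
Qed.

(** A primitive for counting heights of parity b: going from d - 1 to d it gains 1
    exactly when d has parity b. *)
Definition half_floor (b : bool) (d : int) : int := ((d + b%:Z) %/ 2)%Z.

Lemma half_floor_step (b : bool) (k r : nat) :
  half_floor b (k%:Z - r%:Z)
  = half_floor b (k%:Z - r%:Z - 1) + (odd (k + r) == b).
Proof. rewrite /half_floor; case: b => /=; lia. Qed.

Lemma sum_strip (b : bool) (k a m : nat) :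
  (\sum_(a <= r < a + m) (odd (k + r) == b))%N%:Z
  = half_floor b (k%:Z - a%:Z) - half_floor b (k%:Z - (a + m)%N%:Z).
Proof.
elim: m => [|m IHm]; first by rewrite addn0 big_geq // subrr.
rewrite addnS big_nat_recr ?leq_addr //= PoszD IHm.
rewrite (half_floor_step b k (a + m)).
have -> : k%:Z - (a + m).+1%:Z = k%:Z - (a + m)%:Z - 1 by lia.
by ring.
Qed.

(** The stretch of the path from k * H to the next multiple of H, in terms of the
    primitive [half_floor]: the step at k * H goes up from height
    k - 1 - first_above k unless V takes the value k * H, and each later term of V
    is a step down. *)
Lemma sum_between_levels (H N : nat) (V : nat -> nat) (b : bool) k :
    (0 < H)%N -> quasiperiodic H N V ->
  (\sum_(first_above H V k <= r < first_above H V k.+1)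
      (~~ (H %| V r) && (odd (V r %/ H + r) == b)))%N%:Z
    + half_floor b (k%:Z - (first_above H V k.+1)%:Z)
  = half_floor b (k%:Z - 1 - (first_above H V k)%:Z)
    + (~~ (V (first_above H V k) == k * H)%N
       && (odd (k + first_above H V k) == b))%N.
Proof.
move=> H0 qV; set a := first_above H V k; set a' := first_above H V k.+1.
have Vlt := quasiperiodic_lt qV.
have below r : (r < a)%N = (V r < k * H)%N by exact: ltn_first_above qV.
have below' r : (r < a')%N = (V r < k * H + H)%N.
  by rewrite (ltn_first_above _ _ qV) mulSn addnC.
have aa' : (a <= a')%N.
  by rewrite leqNgt below; have := below' a'; rewrite ltnn => /esym/negbT; lia.
have inner r : (a <= r < a')%N -> (V r %/ H = k)%N /\ (H %| V r)%N = (V r == k * H)%N.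
  rewrite leqNgt below below' -leqNgt => /andP[lo hi].
  have e : (V r %/ H = k)%N.
    by apply/eqP; rewrite eqn_leq -ltnS ltn_divLR ?leq_divRL //; lia.
  by split=> //; rewrite dvdn_eq e eq_sym.
(* c = 1 when V takes the value k * H: the path then skips both the step up at
   k * H and the step down at V a. *)
set c := V a == (k * H)%N.
have cut : (a + c <= a')%N.
  by rewrite /c; case: eqP => Va; rewrite ?addn0 // addn1 below'; lia.
have -> : (\sum_(a <= r < a') (~~ (H %| V r) && (odd (V r %/ H + r) == b)) =
           \sum_(a + c <= r < a') (odd (k + r) == b))%N.
  rewrite (big_cat_nat (n := a + c)) ?leq_addr //=.
  have -> : (\sum_(a <= r < a + c)
      (~~ (H %| V r) && (odd (V r %/ H + r) == b)) = 0)%N.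
    move: cut; rewrite /c; case: eqP => Va cut; last by rewrite addn0 big_geq.
    by rewrite addn1 big_nat1 (inner a _).2 ?Va ?eqxx // leqnn -addn1.
  rewrite add0n; apply: eq_big_nat => r /andP[r1 r2].
  have [|-> ->] := inner r; first by rewrite r2 (leq_trans _ r1) ?leq_addr.
  suff -> : (V r == k * H)%N = false by [].
  move: r1; rewrite /c; case: eqP => Va r1.
    by have := Vlt a r; lia.
  apply/negP => /eqP Vr; move: r1; rewrite addn0 leq_eqVlt.
  case/predU1P => [ar|/Vlt]; first by rewrite ar in Va.
  by have := below a; rewrite ltnn => /esym/negbT; lia.
rewrite -(subnKC cut) sum_strip subnKC // addrNK.
have := half_floor_step b k a.
case: c {cut} => /= hs; last by rewrite addn0 hs; congr (half_floor b _ + _); lia.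
by rewrite addr0; congr (half_floor b _); lia.
Qed.

(** Steps up that reach a height of parity b are as many, over a period, as steps
    down that leave one: both counts differ by the variation of [half_floor] along
    the path, which vanishes because a period has as many steps up as down. *)
Lemma crossing_balance (H N : nat) (V : nat -> nat) (b : bool) K :
    (0 < H)%N -> quasiperiodic H N V -> (V 0 < K * H)%N ->
  (\sum_(K <= k < K + N)
     (~~ (V (first_above H V k) == k * H)
      && (odd (k + first_above H V k) == b))
  = \sum_(first_above H V K <= r < first_above H V K + N)
      (~~ (H %| V r) && (odd (V r %/ H + r) == b)))%N.
Proof.
move=> H0 qV V0; rewrite -(first_above_period qV V0); apply/eqP.
rewrite -eqz_nat.
pose g k := half_floor b (k%:Z - 1 - (first_above H V k)%:Z).
have gN : g (K + N)%N = g K.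
  by rewrite /g (first_above_period qV V0); congr (half_floor b _); lia.
have mono : {homo first_above H V : k l / (k <= l)%N}.
  move=> k l kl; rewrite leqNgt (ltn_first_above _ _ qV) -leqNgt.
  have := ltn_first_above k (first_above H V l) qV.
  have := ltn_first_above l (first_above H V l) qV.
  have : (k * H <= l * H)%N by rewrite leq_mul2r kl orbT.
  have := ltn_first_above k (first_above H V k) qV.
  rewrite !ltnn; lia.
suff tele m :
    (\sum_(K <= k < K + m) (~~ (V (first_above H V k) == k * H)
        && (odd (k + first_above H V k) == b)))%N%:Z + g K
    = (\sum_(first_above H V K <= r < first_above H V (K + m))
        (~~ (H %| V r) && (odd (V r %/ H + r) == b)))%N%:Z + g (K + m)%N.
  by have := tele N; rewrite gN => /addIr ->.
elim: m => [|m IHm]; first by rewrite addn0 !big_geq.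
rewrite addnS big_nat_recr ?leq_addr //= PoszD addrAC IHm.
rewrite (big_cat_nat (n := first_above H V (K + m)) (p := first_above H V (K + m).+1));
  [|by apply: mono; rewrite leq_addr|by apply: mono].
rewrite PoszD -!addrA; congr (_ + _).
have := sum_between_levels b (K + m) H0 qV.
rewrite /g => <-; congr (_ + half_floor b _); lia.
Qed.

Lemma sum_window (f : nat -> nat) (N a : nat) :
  (forall r, f (r + N) = f r)%N ->
  (\sum_(a <= r < a + N) f r = \sum_(0 <= r < N) f r)%N.
Proof.
move=> fN; elim: a => [|a <-]; first by rewrite add0n.
case: N fN => [|N] fN; first by rewrite !addn0 !big_geq.
rewrite [RHS]big_ltn ?addnS ?ltnS ?leq_addr // big_nat_recr /=; last by lia.
by rewrite addSn -addnS fN addnC.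
Qed.

(** * Signs of products of sines over a period *)

(** Moving the window by one place replaces the factor w a by w (a + N) = - w a. *)
Lemma prod_antiperiodic (R : comPzRingType) (N : nat) (w : nat -> R) a :
  (0 < N)%N -> (forall i, w (i + N)%N = - w i) ->
  \prod_(j < N) w (j + a)%N = (-1) ^+ a * \prod_(j < N) w j.
Proof.
move=> N0 wN; elim: a => [|a IHa].
  by rewrite expr0 mul1r; apply: eq_bigr => j _; rewrite addn0.
rewrite exprS mulN1r mulNr -IHa {IHa}; case: N N0 wN => // N _ wN.
rewrite big_ord_recr [in RHS]big_ord_recl /= -[(N + a.+1)%N]addSnnS.
rewrite [(N.+1 + a)%N]addnC wN mulrN mulrC add0n; congr (- (_ * _)).
by apply: eq_bigr => j _; rewrite /bump leq0n add1n addSnnS.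
Qed.

Definition level_sine_prod (R : realType) (H N : nat) (V : nat -> nat) (k : nat) : R :=
  \prod_(j < N) sin (pi * ((V (j + k)%N)%:R - (k * H)%:R) / (H * N)%:R).

(** On the window that starts at the first term V a >= k * H all angles lie in
    [0, pi), so the product is positive, or zero when V a = k * H.  The window of
    the definition is reached from there by shifts, each of which changes the
    sign. *)
Lemma level_sine_prod_sign (R : realType) (H N : nat) (V : nat -> nat) k :
    (0 < H)%N -> (0 < N)%N -> quasiperiodic H N V -> (V 0 < k * H)%N ->
  let a := first_above H V k in
  (0 < level_sine_prod R H N V k) = ~~ (V a == k * H)%N && ~~ odd (k + a)
  /\ (level_sine_prod R H N V k < 0) = ~~ (V a == k * H)%N && odd (k + a).
Proof.
move=> H0 N0 qV V0 a; have [_ VN] := qV; have Vlt := quasiperiodic_lt qV.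
have HN0 : 0 < (H * N)%:R :> R by rewrite ltr0n muln_gt0 H0.
pose w i : R := sin (pi * ((V i)%:R - (k * H)%:R) / (H * N)%:R).
have wN i : w (i + N)%N = - w i.
  rewrite /w -sinDpi; congr sin; rewrite VN natrD; field.
  by rewrite !pnatr_eq0 -!lt0n N0 H0.
have a0 : (0 < a)%N by rewrite (ltn_first_above _ _ qV).
have below r : (r < a)%N = (V r < k * H)%N by exact: ltn_first_above qV.
have Va : (k * H <= V a)%N.
  by have := below a; rewrite ltnn => /esym/negbT; rewrite -leqNgt.
have w_gt0 i : (k * H < V i)%N -> (i < a + N)%N -> 0 < w i.
  move=> Vi ia; apply: sin_gt0_pi.
  have Vi' : (V i < k * H + H * N)%N.
    have : (V (a.-1 + N) < k * H + H * N)%N.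
      by rewrite VN ltn_add2r -below prednK.
    have : (V i <= V (a.-1 + N))%N.
      have : (i <= a.-1 + N)%N by lia.
      by rewrite leq_eqVlt => /predU1P[->//|/Vlt/ltnW].
    lia.
  rewrite divr_gt0 ?mulr_gt0 ?pi_gt0 ?subr_gt0 ?ltr_nat //=.
  rewrite ltr_pdivrMr // ltr_pM2l ?pi_gt0 // ltrBlDl -natrD ltr_nat //.
have fromA : level_sine_prod R H N V k
    = (-1) ^+ (k + a) * \prod_(j < N) w (j + a)%N.
  rewrite -[LHS]/(\prod_(j < N) w (j + k)%N).
  rewrite !(prod_antiperiodic _ N0 wN) mulrA -exprD -addnA addnn.
  by rewrite exprD -mul2n exprM sqrrN !expr1n mulr1.
have [Vak|Vak] := eqVneq (V a) (k * H)%N => /=.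
  have wa0 : w a = 0 by rewrite /w Vak subrr mulr0 mul0r sin0.
  by rewrite fromA (bigD1 (Ordinal N0)) //= add0n wa0 mul0r mulr0 ltxx.
have prod0 : 0 < \prod_(j < N) w (j + a)%N.
  apply: prodr_gt0 => j _; apply: w_gt0; last by rewrite addnC ltn_add2l.
  have : (V a <= V (j + a))%N.
    by have := leq_addl j a; rewrite leq_eqVlt => /predU1P[<-//|/Vlt/ltnW].
  by move: Vak Va; lia.
rewrite fromA -signr_odd; case: (odd _) => /=.
  by rewrite expr1 mulN1r oppr_gt0 oppr_lt0 prod0 lt_gtF.
by rewrite expr0 mul1r prod0 lt_gtF.
Qed.

(** * Rotation of the alcove *)

(** The N labels of the affine weight, read cyclically: the residues 0, ..., N - 2
    carry lam_1, ..., lam_(N-1), and N - 1 carries lam_0 = h - sum_k lam_k. *)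
Definition affine_label (N h : nat) (lam : labels N h) (j : nat) : nat :=
  if insub (j %% N)%N is Some k then lam k : nat else (h - \sum_k lam k)%N.

Definition label_sum (N h : nat) (lam : labels N h) (j : nat) : nat :=
  \sum_(0 <= i < j) affine_label lam i.

(** With x = (e_(j+1), lam), j < N, this is 2 h (k + N) for the real k at which
    cos (pi (x / h + k / N)) vanishes, that is k = N (1/2 - x / h); the shift by
    2 h N keeps the level in nat ([wdot_weight], [level_offset]). *)
Definition level (N h : nat) (lam : labels N h) (j : nat) : nat :=
  (2 * N * label_sum lam j + 3 * h * N - 2 * \sum_(i < N) label_sum lam i)%N.

(** For N > 1 the affine labels of an alcove weight are smaller than h
    ([affine_label_lt]), and insubd keeps their value. *)
Definition rotate_labels (N h : nat) (lam : labels N h) : labels N h :=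
  [ffun k => insubd (lam k) (affine_label lam k.+1)].

Definition rotate_alcove (N h : nat) (lam : alcove N h) : alcove N h :=
  insubd lam (rotate_labels (val lam)).

Lemma affine_label_ord (N h : nat) (lam : labels N h) (k : 'I_N.-1) :
  affine_label lam k = lam k.
Proof.
have kN : (k < N)%N by have := ltn_ord k; lia.
rewrite /affine_label modn_small //; case: insubP => [u _ uk|/negP[]//].
by congr (nat_of_ord (lam _)); apply: val_inj.
Qed.

Lemma affine_label_last (N h : nat) (lam : labels N h) :
  (0 < N)%N -> affine_label lam N.-1 = (h - \sum_k lam k)%N.
Proof.
move=> N0; rewrite /affine_label modn_small ?ltn_predL //.
by case: insubP => // u; rewrite ltnn.
Qed.

Lemma affine_label_mod (N h : nat) (lam : labels N h) j :
  affine_label lam (j %% N) = affine_label lam j.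
Proof. by rewrite /affine_label modn_mod. Qed.

Lemma label_sumD (N h : nat) (lam : labels N h) i j :
  label_sum lam (i + j)%N
  = (label_sum lam i + \sum_(0 <= k < j) affine_label lam (i + k))%N.
Proof.
rewrite /label_sum (big_cat_nat (n := i)) ?leq_addr //=; congr (_ + _)%N.
rewrite -{1}[i in LHS]add0n big_addn addKn.
by apply: eq_bigr => k _; rewrite addnC.
Qed.

Lemma label_sum_last (N h : nat) (lam : labels N h) :
  label_sum lam N.-1 = (\sum_k lam k)%N.
Proof.
rewrite /label_sum big_mkord.
by apply: eq_bigr => k _; rewrite affine_label_ord.
Qed.

Lemma label_sumN (N h : nat) (lam : labels N h) :
  (0 < N)%N -> in_alcove lam -> label_sum lam N = h.
Proof.
move=> N0 /andP[_ slt].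
have -> : label_sum lam N = label_sum lam N.-1.+1 by rewrite prednK.
rewrite /label_sum big_nat_recr //=.
rewrite -/(label_sum lam N.-1) label_sum_last affine_label_last // subnKC //; exact: ltnW.
Qed.

Lemma affine_label_gt0 (N h : nat) (lam : labels N h) j :
  in_alcove lam -> (0 < affine_label lam j)%N.
Proof.
case/andP=> /forallP pos slt; rewrite /affine_label.
by case: insub => [k|]; [exact: pos|rewrite subn_gt0].
Qed.

Lemma label_sum_period (N h : nat) (lam : labels N h) j :
  (0 < N)%N -> in_alcove lam -> label_sum lam (j + N)%N = (label_sum lam j + h)%N.
Proof.
move=> N0 ilam; rewrite addnC label_sumD label_sumN // addnC; congr (_ + _)%N.
apply: eq_bigr => k _.
by rewrite -affine_label_mod modnDl affine_label_mod.
Qed.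

Lemma label_sum_le (N h : nat) (lam : labels N h) i j :
  (i <= j)%N -> (label_sum lam i <= label_sum lam j)%N.
Proof. by move=> ij; rewrite -(subnKC ij) label_sumD leq_addr. Qed.

Lemma affine_label_lt (N h : nat) (lam : labels N h) j :
  (1 < N)%N -> in_alcove lam -> (affine_label lam j < h)%N.
Proof.
move=> N1 ilam; rewrite /affine_label; case: insub => [k|]; first exact: ltn_ord.
have := ilam; case/andP=> /forallP pos slt; rewrite ltn_subrL (leq_trans _ slt) //.
have k0 : (0 < N.-1)%N by rewrite -subn1 subn_gt0.
by rewrite (bigD1 (Ordinal k0)) //= andbT addn_gt0 pos.
Qed.

Lemma affine_label_rotate (N h : nat) (lam : labels N h) j :
  (1 < N)%N -> in_alcove lam ->
  affine_label (rotate_labels lam) j = affine_label lam j.+1.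
Proof.
move=> N1 ilam; have N0 := ltnW N1.
have rotE (k : 'I_N.-1) : rotate_labels lam k = affine_label lam k.+1 :> nat.
  by rewrite ffunE val_insubd affine_label_lt.
rewrite -affine_label_mod -[RHS]affine_label_mod -addn1 -modnDml addn1.
have := ltn_pmod j N0; move: (j %% N)%N => {}j; rewrite -ltnS => jN.
have [jlt|] := ltnP j N.-1.
  by rewrite (affine_label_ord _ (Ordinal jlt)) rotE affine_label_mod.
(* The last affine label of the rotated weight is h minus the sum of all labels of
   lam but the first, that is the first one. *)
move=> Nj; have -> : j = N.-1 by lia.
rewrite prednK // modnn affine_label_last //.
under eq_bigr => k _ do rewrite rotE.
have := label_sumN N0 ilam.
have -> : label_sum lam N = label_sum lam (1 + N.-1)%N by rewrite add1n prednK.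
rewrite label_sumD.
rewrite big_mkord /label_sum big_nat1.
under [X in (_ + X)%N]eq_bigr => k _ do rewrite add1n.
lia.
Qed.

Lemma rotate_in_alcove (N h : nat) (lam : labels N h) :
  (1 < N)%N -> in_alcove lam -> in_alcove (rotate_labels lam).
Proof.
move=> N1 ilam; have N0 := ltnW N1; apply/andP; split.
  by apply/forallP=> k; rewrite -affine_label_ord affine_label_rotate // affine_label_gt0.
rewrite -label_sum_last /label_sum.
under eq_bigr => k _ do rewrite affine_label_rotate //.
have := label_sumN N0 ilam.
have -> : label_sum lam N = label_sum lam (1 + N.-1)%N by rewrite add1n prednK.
rewrite label_sumD.
rewrite {1}/label_sum big_nat1.
under [X in (_ + X)%N]eq_bigr => k _ do rewrite add1n.
by have := affine_label_gt0 0 ilam; lia.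
Qed.

Lemma val_rotate_alcove (N h : nat) (lam : alcove N h) :
  (1 < N)%N -> val (rotate_alcove lam) = rotate_labels (val lam).
Proof. by move=> N1; rewrite val_insubd rotate_in_alcove ?(valP lam). Qed.

Lemma rotate_alcove_inj (N h : nat) :
  (1 < N)%N -> injective (@rotate_alcove N h).
Proof.
move=> N1 lam mu /(congr1 val); rewrite !val_rotate_alcove // => eq_rot.
have N0 := ltnW N1.
have eqS j : affine_label (val lam) j.+1 = affine_label (val mu) j.+1.
  by rewrite -!affine_label_rotate ?(valP lam) ?(valP mu) // eq_rot.
apply/val_inj/ffunP=> k; apply: val_inj; rewrite /= -!affine_label_ord.
rewrite -affine_label_mod -[RHS]affine_label_mod.
rewrite -(modnDr k N) !affine_label_mod.
have -> : (k + N = (k + N.-1).+1)%N by rewrite -addnS prednK.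
exact: eqS.
Qed.

Lemma label_sum_rotate (N h : nat) (lam : labels N h) j :
  (1 < N)%N -> in_alcove lam ->
  (label_sum lam 1 + label_sum (rotate_labels lam) j = label_sum lam j.+1)%N.
Proof.
move=> N1 ilam; rewrite [RHS](label_sumD lam 1); congr (_ + _)%N.
by apply: eq_bigr => k _; rewrite affine_label_rotate.
Qed.

Lemma sum_label_sum_rotate (N h : nat) (lam : labels N h) :
  (1 < N)%N -> in_alcove lam ->
  (N * label_sum lam 1 + \sum_(i < N) label_sum (rotate_labels lam) i
   = \sum_(i < N) label_sum lam i + h)%N.
Proof.
move=> N1 ilam; have N0 := ltnW N1.
have -> : (N * label_sum lam 1 = \sum_(i < N) label_sum lam 1)%N.
  by rewrite sum_nat_const card_ord.
rewrite -big_split /=.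
under eq_bigr => i _ do rewrite label_sum_rotate //.
case: N N1 N0 lam ilam => // N N1 N0 lam ilam.
rewrite big_ord_recr [in RHS]big_ord_recl /= label_sumN //.
by rewrite {2}/label_sum big_geq // add0n.
Qed.

Lemma level_offset (N h : nat) (lam : labels N h) :
  (0 < N)%N -> in_alcove lam -> (2 * \sum_(i < N) label_sum lam i <= 3 * h * N)%N.
Proof.
move=> N0 ilam.
have : (\sum_(i < N) label_sum lam i <= \sum_(i < N) h)%N.
  apply: leq_sum => i _; rewrite -[leqRHS](label_sumN N0 ilam).
  exact/label_sum_le/ltnW.
rewrite sum_nat_const card_ord; nia.
Qed.

Lemma level_quasiperiodic (N h : nat) (lam : labels N h) :
  (0 < N)%N -> in_alcove lam -> quasiperiodic (2 * h) N (level lam).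
Proof.
move=> N0 ilam; have off := level_offset N0 ilam; rewrite /level; split=> j.
  have : (label_sum lam j < label_sum lam j.+1)%N.
    by rewrite {2}/label_sum big_nat_recr //= -addn1 leq_add2l affine_label_gt0.
  nia.
rewrite label_sum_period //; nia.
Qed.

(** Up to a shift of the index and a translation by 2 h, the weights of an orbit
    share one sequence of levels. *)
Lemma level_rotate (N h : nat) (lam : labels N h) j :
  (1 < N)%N -> in_alcove lam ->
  (level (rotate_labels lam) j + 2 * h = level lam j.+1)%N.
Proof.
move=> N1 ilam; have N0 := ltnW N1.
have off := level_offset N0 ilam.
have off' := level_offset N0 (rotate_in_alcove N1 ilam).
have sumE := sum_label_sum_rotate N1 ilam.
rewrite /level -(label_sum_rotate j N1 ilam); nia.
Qed.

Lemma level_iter_rotate (N h : nat) (lam : alcove N h) k j :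
  (1 < N)%N ->
  (level (val (iter k (@rotate_alcove N h) lam)) j + k * (2 * h)
   = level (val lam) (j + k))%N.
Proof.
move=> N1; elim: k j => [|k IHk] j; first by rewrite mul0n !addn0.
rewrite iterS val_rotate_alcove // mulSn addnA level_rotate ?(valP _) //.
by rewrite IHk addSnnS.
Qed.

(** A bound uniform in lam: it lets the counts for all weights run over the same
    window of rotations, k from 2 N to 3 N - 1. *)
Lemma level0_lt (N h : nat) (lam : labels N h) :
  (0 < N)%N -> (0 < h)%N -> (level lam 0 < 2 * N * (2 * h))%N.
Proof.
move=> N0 h0; rewrite /level [label_sum lam 0]big_geq // muln0 add0n.
apply: leq_ltn_trans (leq_subr _ _) _; nia.
Qed.

(** * Weights, numbers q and eigenvalues in terms of levels *)

Lemma label_sum_indicator (N h : nat) (lam : labels N h) j :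
  (j < N)%N -> label_sum lam j = (\sum_(k < N.-1) (k < j) * lam k)%N.
Proof.
move=> jN; have jN' : (j <= N.-1)%N by lia.
rewrite /label_sum (big_nat_widen _ _ _ _ _ jN') big_mkord big_mkcond /=.
by apply: eq_bigr => k _; rewrite affine_label_ord; case: (k < j)%N; rewrite ?mul1n ?mul0n.
Qed.

Lemma sum_label_sum (N h : nat) (lam : labels N h) :
  (\sum_(j < N) label_sum lam j = \sum_(k < N.-1) (N - k.+1) * lam k)%N.
Proof.
under eq_bigr => j _ do rewrite label_sum_indicator //.
rewrite exchange_big /=; apply: eq_bigr => k _; rewrite -big_distrl /=; congr (_ * _)%N.
by move: (nat_of_ord k) => {}k; elim: N {lam} => [|N IHN];
  [rewrite big_ord0|rewrite big_ord_recr /= IHN; lia].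
Qed.

(** Consecutive products x_j = (e_j, lam) differ by the labels and their sum is 0, so
    that x_1 is the mean of the partial sums of the labels. *)
Lemma wdot_weight (R : realType) (N h : nat) (lam : labels N h) (j : 'I_N) :
  wdot (std_weight R j) (weight_vec R lam)
  = (\sum_(i < N) label_sum lam i)%N%:R / N%:R - (label_sum lam j)%:R.
Proof.
have N0 : (0 < N)%N by have := ltn_ord j; lia.
have N0' : N%:R != 0 :> R by rewrite pnatr_eq0 -lt0n.
have fundE (k : 'I_N.-1) :
    wdot (std_weight R j) (fund_weight R k) = (j <= k)%N%:R - k.+1%:R / N%:R.
  have -> : wdot (std_weight R j) (fund_weight R k) =
      \sum_(i < N | (i <= k)%N) wdot (std_weight R j) (std_weight R i).
    by rewrite /wdot /fund_weight linear_sum mulmx_sumr summxE.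
  under eq_bigr => i _ do rewrite wdot_std_weight.
  rewrite sumrB; congr (_ - _).
    rewrite big_mkcond (bigD1 j) //= eqxx big1 ?addr0; first by case: leqP.
    by move=> i /negbTE ji; rewrite eq_sym ji; case: ifP.
  rewrite sumr_const -[_^-1 *+ _]mulr_natl; congr (_%:R * _).
  rewrite -sum1_card big_mkcond /=.
  have := ltn_ord k; move: (nat_of_ord k) => {j N0'} {}k kN.
  have {kN} -> : k.+1 = minn N k.+1 by lia.
  transitivity (\sum_(i < N) (i <= k))%N.
    by apply: eq_bigr => i _; rewrite -[_ \in _]/(i <= k)%N; case: (i <= k)%N.
  clear; elim: N => [|N IHN]; [by rewrite big_ord0 min0n|by rewrite big_ord_recr /= IHN; lia].
have -> : wdot (std_weight R j) (weight_vec R lam) =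
    \sum_k (lam k)%:R * wdot (std_weight R j) (fund_weight R k).
  rewrite /wdot /weight_vec linear_sum mulmx_sumr summxE.
  by apply: eq_bigr => k _; rewrite linearZ -scalemxAr mxE.
rewrite label_sum_indicator // sum_label_sum !natr_sum mulr_suml -sumrB.
apply: eq_bigr => k _; rewrite fundE !natrM natrB; last by have := ltn_ord k; lia.
by rewrite leqNgt; case: (k < j)%N => /=; field.
Qed.

(** The weighted sum of the labels is N times the sum of all labels minus the sum of
    the partial sums. *)
Lemma qR_level (R : realType) (N h : nat) (lam : labels N h) :
  (0 < N)%N -> (0 < h)%N -> in_alcove lam ->
  qR R lam + 1 / 2 = (level lam N.-1)%:R / (2 * h)%:R - N.-1%:R - N%:R.
Proof.
move=> N0 h0 ilam; have off := level_offset N0 ilam.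
have h0' : h%:R != 0 :> R by rewrite pnatr_eq0 -lt0n.
have sumE : \sum_(k < N.-1) k.+1%:R * ((lam k)%:R - 1) =
    N%:R * (label_sum lam N.-1)%:R - (\sum_(i < N) label_sum lam i)%N%:R
    - N%:R * (N%:R - 1) / 2 :> R.
  rewrite sum_label_sum label_sum_last !natr_sum mulr_sumr -sumrB.
  have -> : N%:R * (N%:R - 1) / 2 = \sum_(k < N.-1) k.+1%:R :> R.
    rewrite -[in LHS](prednK N0); move: N.-1 => M.
    elim: M => [|M IHM]; first by rewrite big_ord0; field.
    by rewrite big_ord_recr /= -IHM !mulrS; field.
  rewrite -sumrB; apply: eq_bigr => k _.
  by rewrite natrM natrB; [ring|have := ltn_ord k; lia].
rewrite /qR sumE /level natrB; last by lia.
have -> : N.-1%:R = N%:R - 1 :> R by rewrite -subn1 natrB.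
by rewrite natrD !natrM; field.
Qed.

(** The exterior power of a diagonal matrix is diagonal, and its diagonal minors are
    products of diagonal entries. *)
Lemma chi_diag (K : comPzRingType) (N p : nat) (d : 'rV[K]_N) :
  chi p (diag_mx d) = \sum_(I : {set 'I_N} | #|I| == p) \prod_(i in I) d 0 i.
Proof.
have nth_inj (I : psubset N p) : injective (psubset_nth I).
  by move=> i j /enum_val_inj /cast_ord_inj.
have minorE (I : psubset N p) :
    \det (mxsub (psubset_nth I) (psubset_nth I) (diag_mx d))
    = \prod_(i in val I) d 0 i.
  have -> : mxsub (psubset_nth I) (psubset_nth I) (diag_mx d)
      = diag_mx (\row_i d 0 (psubset_nth I i)).
    by apply/matrixP=> i j; rewrite !mxE (inj_eq (nth_inj I)).
  rewrite det_diag [RHS]big_enum_val.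
  rewrite [RHS](reindex (cast_ord (esym (eqP (valP I))))) /=.
    by apply: eq_bigr => i _; rewrite mxE.
  by exists (cast_ord (eqP (valP I))) => i _; rewrite ?cast_ordK ?cast_ordKV.
rewrite /chi /mxtrace.
under eq_bigr => i _ do rewrite mxE minorE.
rewrite -(big_enum_val (fun I : psubset N p => \prod_(i in val I) d 0 i)).
symmetry; rewrite -[LHS]/(\sum_(I in (fun I : {set 'I_N} => #|I| == p)) _) [LHS]big_sub.
by apply: eq_bigl => I; rewrite inE.
Qed.

Lemma sum_chi_diag (K : comPzRingType) (N : nat) (d : 'rV[K]_N) :
  \sum_(p < N.+1) chi p (diag_mx d) = \prod_i (1 + d 0 i).
Proof.
under [LHS]eq_bigr => p _ do rewrite chi_diag.
under [RHS]eq_bigr => i _ do rewrite addrC.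
rewrite bigA_distr /=.
under [RHS]eq_bigr => I _ do rewrite -big_mkcond /=.
have cardN (I : {set 'I_N}) : (#|I| < N.+1)%N.
  by rewrite ltnS -[leqRHS]card_ord max_card.
by rewrite [RHS](partition_big (fun I : {set 'I_N} => Ordinal (cardN I)) predT) //=.
Qed.

Lemma chi0_diag (K : comPzRingType) (N : nat) (d : 'rV[K]_N) :
  chi 0 (diag_mx d) = 1.
Proof.
rewrite chi_diag (big_pred1 set0) ?big_set0 // => I.
by rewrite cards_eq0.
Qed.

Lemma chiN_diag (K : comPzRingType) (N : nat) (d : 'rV[K]_N) :
  chi N (diag_mx d) = \prod_i d 0 i.
Proof.
rewrite chi_diag (big_pred1 setT) => [|I].
  by apply: eq_bigl => i; rewrite inE.
have IN : (#|I| <= N)%N by rewrite -[leqRHS]card_ord max_card.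
by rewrite /= [RHS]eqEcard subsetT cardsT card_ord eqn_leq IN.
Qed.

Lemma chi_diag_scale_reindex (K : comPzRingType) (N p : nat) (d d' : 'rV[K]_N)
    (s : 'I_N -> 'I_N) (w : K) :
  injective s -> (forall i, d' 0 i = w * d 0 (s i)) ->
  chi p (diag_mx d') = w ^+ p * chi p (diag_mx d).
Proof.
move=> s_inj d'E; rewrite !chi_diag mulr_sumr.
rewrite [RHS](reindex_inj (imset_inj s_inj)) /=.
apply: eq_big => [I|I /eqP <-]; first by rewrite card_imset.
rewrite big_imset /=; last by move=> i j _ _; exact: s_inj.
by under eq_bigr => i _ do rewrite d'E; rewrite big_split /= prodr_const.
Qed.

Lemma cexpiD (R : realType) (s t : R) : cexpi (s + t) = cexpi s * cexpi t.
Proof.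
by apply/eqP; rewrite /cexpi eq_complex /= sinD cosD !eqxx addrC [sin s * _]mulrC eqxx.
Qed.

Lemma cexpi0 (R : realType) : cexpi (0 : R) = 1.
Proof. by rewrite /cexpi cos0 sin0. Qed.

Lemma prod_cexpi (R : realType) (N : nat) (t : 'I_N -> R) :
  \prod_i cexpi (t i) = cexpi (\sum_i t i).
Proof.
by symmetry; apply: (big_morph _ (@cexpiD R) (cexpi0 R)).
Qed.

Lemma cexpi_add1 (R : realType) (t : R) :
  1 + cexpi t = (2 * cos (t / 2))%:C%C * cexpi (t / 2).
Proof.
have {1}-> : t = t / 2 + t / 2 by field.
rewrite cexpiD; apply/eqP; rewrite /cexpi eq_complex /=.
have := cos2Dsin2 (t / 2); set c := cos _; set s := sin _ => cs.
apply/andP; split; apply/eqP; last by ring.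
by rewrite -[X in X + _]cs; ring.
Qed.

Lemma cexpi_2pi (R : realType) : cexpi (pi *+ 2 : R) = 1.
Proof. by rewrite /cexpi cos2pi sin2pi. Qed.

(** Rotation adds h / N to the products (e_j, lam) and permutes them cyclically; the
    one that goes round also loses h, a full turn of the angle. *)
Lemma epsilon_rotate (R : realType) (N h : nat) (lam : labels N h) (j : 'I_N) :
  (1 < N)%N -> (0 < h)%N -> in_alcove lam ->
  epsilon R (rotate_labels lam) j
  = cexpi (- (pi *+ 2 / N%:R)) * epsilon R lam (ordS j).
Proof.
move=> N1 h0 ilam; have N0 := ltnW N1.
have N0' : N%:R != 0 :> R by rewrite pnatr_eq0 -lt0n.
have h0' : h%:R != 0 :> R by rewrite pnatr_eq0 -lt0n.
rewrite /epsilon !wdot_weight -cexpiD.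
have /(congr1 (fun x => x%:R : R)) := sum_label_sum_rotate N1 ilam.
rewrite !natrD natrM; set T := (\sum_(i < N) _)%N;
  set T' := (\sum_(i < N) _)%N => TT.
have /(congr1 (fun x => x%:R : R)) := label_sum_rotate j N1 ilam.
rewrite natrD => SS.
have TE : T%:R = T'%:R + h%:R - N%:R * (label_sum lam 1)%:R :> R by rewrite -TT; ring.
rewrite TE; have {SS}-> : (label_sum (rotate_labels lam) j)%:R
    = (label_sum lam j.+1)%:R - (label_sum lam 1)%:R :> R by rewrite -SS; ring.
have [jN|Nj] := ltnP j.+1 N.
  by rewrite /= modn_small //; congr cexpi; field; rewrite h0' N0'.
have jE : j.+1 = N by apply/eqP; rewrite eqn_leq Nj ltn_ord.
rewrite /= jE modnn label_sumN // {3}/label_sum big_geq //.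
rewrite -[RHS]mul1r -(cexpi_2pi R) -!cexpiD.
by congr cexpi; field; rewrite h0' N0'.
Qed.

Lemma gamma_rotate (R : realType) (N h p : nat) (lam : labels N h) :
  (1 < N)%N -> (0 < h)%N -> in_alcove lam ->
  gamma R p (rotate_labels lam)
  = cexpi (- (pi *+ 2 / N%:R)) ^+ p * gamma R p lam.
Proof.
move=> N1 h0 ilam; apply: chi_diag_scale_reindex (@ordS_inj N) _ => j.
by rewrite !mxE epsilon_rotate.
Qed.

(** The product 2^N prod_j cos (pi x_j / h) with the cosines rewritten as sines of
    the levels. *)
Definition form_eigenvalue (R : realType) (N h : nat) (lam : labels N h) : R :=
  (-2) ^+ N * level_sine_prod R (2 * h) N (level lam) 0.

(** The summand 2 supplies chi_0 and chi_N, and 1 + exp (i t) = 2 cos (t / 2) exp (i t / 2);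
    the phases cancel because the angles have sum 0. *)
Lemma sum_gamma (R : realType) (N h : nat) (lam : labels N h) :
  (1 < N)%N -> (0 < h)%N -> in_alcove lam ->
  2 + \sum_(1 <= p < N) gamma R p lam = (form_eigenvalue R lam)%:C%C.
Proof.
move=> N1 h0 ilam; have N0 := ltnW N1.
have N0' : N%:R != 0 :> R by rewrite pnatr_eq0 -lt0n.
have h0' : h%:R != 0 :> R by rewrite pnatr_eq0 -lt0n.
pose T : nat := (\sum_(i < N) label_sum lam i)%N.
pose t (j : 'I_N) : R := - (2 * pi / h%:R) * (T%:R / N%:R - (label_sum lam j)%:R).
have eps j : epsilon R lam j = cexpi (t j) by rewrite /epsilon wdot_weight.
have t0 : \sum_j t j = 0.
  rewrite -mulr_sumr sumrB sumr_const card_ord -natr_sum -/T.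
  by rewrite -[_ *+ N]mulr_natr mulfVK // subrr mulr0.
have chi0 : gamma R 0 lam = 1 by exact: chi0_diag.
have chiN : gamma R N lam = 1.
  rewrite [LHS]chiN_diag; under eq_bigr => j _ do rewrite mxE eps.
  by rewrite prod_cexpi t0 cexpi0.
have -> : 2 + \sum_(1 <= p < N) gamma R p lam = \sum_(p < N.+1) gamma R p lam.
  rewrite -(big_mkord predT (fun p => gamma R p lam)) big_nat_recr //= chiN.
  by rewrite [X in _ = X + _]big_ltn // chi0; ring.
rewrite [LHS]sum_chi_diag.
under eq_bigr => j _ do rewrite mxE eps cexpi_add1.
rewrite big_split /= prod_cexpi -mulr_suml t0 mul0r cexpi0 mulr1 -rmorph_prod /=.
congr (_%:C%C); rewrite /form_eigenvalue /level_sine_prod.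
have -> : (-2) ^+ N = \prod_(j < N) (-2) :> R by rewrite prodr_const card_ord.
rewrite -big_split /=.
apply: eq_bigr => j _; rewrite mul0n subr0 addn0.
rewrite mulNr -mulrN; congr (_ * _).
have off := level_offset N0 ilam.
have -> : pi * (level lam j)%:R / (2 * h * N)%:R = t j / 2 + pi + pi / 2 :> R.
  rewrite /level natrB; last by lia.
  by rewrite natrD !natrM -/T /t; field; rewrite N0' h0'.
by rewrite sinDpihalf cosDpi opprK.
Qed.

Lemma form_eigenvalue_iter_rotate (R : realType) (N h : nat) (lam : alcove N h) k :
  (1 < N)%N ->
  form_eigenvalue R (val (iter k (@rotate_alcove N h) lam))
  = (-2) ^+ N * level_sine_prod R (2 * h) N (level (val lam)) k.
Proof.
move=> N1; congr (_ * _); apply: eq_bigr => j _; congr (sin (_ * _ / _)).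
by rewrite addn0 mul0n subr0 -(level_iter_rotate lam k j N1) natrD addrK.
Qed.

(** * Balance over a rotation orbit *)

(** The level with index N - 1 determines q ([qR_level]).  The class b = odd N is that
    of the q near even integers, the other one that of the q near odd integers
    ([q_interval_class]). *)
Definition q_class (N h : nat) (b : bool) (lam : labels N h) : bool :=
  ~~ (2 * h %| level lam N.-1)%N && (odd (level lam N.-1 %/ (2 * h) + N.-1) == b).

(** Indexed like [q_class]: b is the parity of the height of the path, and the factor
    (-2)^N of the eigenvalue turns b = odd N into the positive sign. *)
Definition form_sign (R : realType) (N h : nat) (b : bool) (lam : labels N h) : bool :=
  if b == odd N then 0 < form_eigenvalue R lam else form_eigenvalue R lam < 0.

Lemma q_class_iter_rotate (N h k : nat) (b : bool) (lam : alcove N h) :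
  (1 < N)%N -> (0 < h)%N ->
  q_class b (val (iter k (@rotate_alcove N h) lam)) =
  ~~ (2 * h %| level (val lam) (N.-1 + k))%N
  && (odd (level (val lam) (N.-1 + k) %/ (2 * h) + (N.-1 + k)) == b).
Proof.
move=> N1 h0; rewrite /q_class -(level_iter_rotate lam k N.-1 N1).
rewrite dvdn_addl; last exact: dvdn_mull.
rewrite divnDMl ?muln_gt0 //.
set L := level _ _.
have -> : (L %/ (2 * h) + k + (N.-1 + k)
    = L %/ (2 * h) + N.-1 + k.*2)%N by lia.
by rewrite [odd (_ + k.*2)]oddD odd_double addbF.
Qed.

Lemma form_sign_iter_rotate (R : realType) (N h k : nat) (b : bool) (lam : alcove N h) :
  (1 < N)%N -> (0 < h)%N -> (2 * N <= k)%N ->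
  let V := level (val lam) in let a := first_above (2 * h) V k in
  form_sign R b (val (iter k (@rotate_alcove N h) lam)) =
  ~~ (V a == k * (2 * h))%N && (odd (k + a) == b).
Proof.
move=> N1 h0 Nk V a; have N0 := ltnW N1.
have H0 : (0 < 2 * h)%N by rewrite muln_gt0.
have V0 : (V 0 < k * (2 * h))%N.
  by apply: leq_trans (level0_lt (val lam) N0 h0) _; rewrite leq_mul2r Nk orbT.
have [pos neg] := level_sine_prod_sign R H0 N0 (level_quasiperiodic N0 (valP lam)) V0.
rewrite /form_sign form_eigenvalue_iter_rotate //.
rewrite -mulN1r exprMn -signr_odd -mulrA.
have pow0 : (0 : R) < 2 ^+ N by rewrite exprn_gt0.
rewrite -/V in pos neg *; move: pos neg; rewrite -/a; set P := level_sine_prod _ _ _ _ _.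
by case: b; case: (odd N); rewrite /= ?expr1 ?expr0 ?mulN1r ?mul1r ?oppr_gt0 ?oppr_lt0
  ?pmulr_rlt0 ?pmulr_rgt0 // => pos neg; rewrite ?pos ?neg; case: (odd _).
Qed.

Lemma orbit_balance (R : realType) (N h : nat) (b : bool) (lam : alcove N h) :
  (1 < N)%N -> (0 < h)%N ->
  (\sum_(2 * N <= k < 2 * N + N) q_class b (val (iter k (@rotate_alcove N h) lam))
   = \sum_(2 * N <= k < 2 * N + N)
       form_sign R b (val (iter k (@rotate_alcove N h) lam)))%N.
Proof.
move=> N1 h0; have N0 := ltnW N1.
have H0 : (0 < 2 * h)%N by rewrite muln_gt0.
have qV := level_quasiperiodic N0 (valP lam).
under [RHS]eq_big_nat => k /andP[Nk _] do rewrite form_sign_iter_rotate //.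
rewrite [RHS](crossing_balance b H0 qV (level0_lt (val lam) N0 h0)).
pose f r : nat := ~~ (2 * h %| level (val lam) r)%N
  && (odd (level (val lam) r %/ (2 * h) + r) == b).
have fN r : f (r + N)%N = f r.
  rewrite /f (qV.2 r) [(_ * N)%N]mulnC dvdn_addl; last exact: dvdn_mull.
  rewrite divnDMl // addnACA addnn [odd (_ + N.*2)]oddD odd_double addbF //.
under [LHS]eq_big_nat => k _ do rewrite q_class_iter_rotate // -/(f _).
rewrite [RHS](sum_window _ fN) -[RHS](sum_window N.-1 fN).
rewrite -{1}[N.-1 in RHS]add0n big_addn addKn.
rewrite (sum_window (f := fun k => f (N.-1 + k)%N)) => [|r]; last by rewrite addnA fN.
by apply: eq_bigr => k _; rewrite addnC.
Qed.

(** * Multiplicities are invariant under rotation *)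

(** Right multiplication by D is injective and sends one joint eigenspace into the
    other. *)
Lemma rank_joint_eigenspace_twist (F : fieldType) (n a b : nat)
    (A : nat -> 'M[F]_n) (g c : nat -> F) (D : 'M[F]_n) :
  D \in unitmx ->
  (forall p, (a <= p < b)%N -> D *m A p = c p *: (A p *m D)) ->
  (\rank (\bigcap_(a <= p < b) eigenspace (A p) (g p))%MS
   <= \rank (\bigcap_(a <= p < b) eigenspace (A p) (c p * g p))%MS)%N.
Proof.
move=> D_unit twist; rewrite !(big_geq_mkord a b (fun=> true)).
have D_free : row_free D by rewrite row_free_unit.
set W := (\bigcap_(_ < _ | _) eigenspace _ (g _))%MS.
rewrite -(mxrankMfree W D_free).
apply: mxrankS; apply/sub_bigcapmxP => p ap.
have WE : W *m A p = g p *: W.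
  by apply/eigenspaceP; apply: bigcapmx_inf (submx_refl _).
apply/eigenspaceP.
rewrite -mulmxA twist ?ltn_ord ?andbT // -scalemxAr mulmxA WE -scalemxAl.
by rewrite scalerA.
Qed.

(** (G_p)_(ab) vanishes unless tau(b) = tau(a) + p, hence conjugation by the diagonal
    matrix of the w^tau(a) multiplies G_p by a p-th power of w. *)
Lemma eig_mult_twist_le (R : realType) (N n : nat) (S : class_II R N n)
    (lam mu : labels N (altitude S)) (w : R[i]) :
  (1 < N)%N -> w ^+ N = 1 ->
  (forall p, (0 < p < N)%N -> gamma R p mu = w ^+ p * gamma R p lam) ->
  (eig_mult R (gadj S) lam <= eig_mult R (gadj S) mu)%N.
Proof.
move=> N1 wN gammaE; have N0 := ltnW N1.
have w0 : w != 0.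
  apply/eqP => w0; move/eqP: wN.
  by rewrite w0 expr0n gtn_eqF // eq_sym oner_eq0.
pose D := diag_mx (\row_a w ^+ (vtau S a)).
have D_unit : D \in unitmx.
  rewrite unitmxE det_diag unitfE; apply/prodf_neq0 => a _.
  by rewrite mxE expf_neq0.
have twist p : (0 < p < N)%N -> D *m (adj_mx R[i] (gadj S p))^T
    = w ^+ p *: ((adj_mx R[i] (gadj S p))^T *m D).
  move=> pN; apply/matrixP => a c; rewrite mul_diag_mx mxE mul_mx_diag !mxE.
  have [tau_eq|/eqP tau_neq] := eqVneq (vtau S a) (vtau S c + p%:R); last first.
    by rewrite (gadj_grading pN tau_neq) mulr0 mul0r mulr0.
  rewrite mulrCA -exprD mulrC; congr (_ * _).
  have -> : nat_of_ord (vtau S a) = ((p + vtau S c) %% N)%N.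
    have modE x : (x %% (Zp_trunc N).+2 = x %% N)%N by rewrite Zp_cast.
    by rewrite tau_eq [LHS]modE val_Zp_nat // modnDmr addnC.
  by rewrite expr_mod.
have -> : eig_mult R (gadj S) mu = (\rank (\bigcap_(1 <= p < N)
    eigenspace (adj_mx R[i] (gadj S p))^T (w ^+ p * gamma R p lam))%MS).
  rewrite /eig_mult; congr (\rank _); apply: eq_big_nat => p pN.
  by rewrite (gammaE _ pN).
exact: (rank_joint_eigenspace_twist (fun p => gamma R p lam) D_unit twist).
Qed.

(** The dual family w makes the matrix of eigenvectors invertible, and det is
    multiplicative. *)
Lemma char_poly_eigenbasis (F : fieldType) (I : finType) (n : nat)
    (A : 'M[F]_n) (v : I -> 'cV[F]_n) (w : I -> 'I_n -> F) (m : I -> F) :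
  #|I| = n ->
  (forall i j, \sum_a w i a * v j a 0 = (i == j)%:R) ->
  (forall i, A *m v i = m i *: v i) ->
  char_poly A = \prod_i ('X - (m i)%:P).
Proof.
move=> cardI; case: n / cardI A v w => A v w dual eigen.
pose P := \matrix_(a < #|I|, i < #|I|) v (enum_val i) a 0.
pose D := diag_mx (\row_(i < #|I|) m (enum_val i)).
have PW : (\matrix_(i < #|I|, a < #|I|) w (enum_val i) a) *m P = 1%:M.
  apply/matrixP=> i j; rewrite !mxE.
  under eq_bigr => a _ do rewrite !mxE.
  by rewrite dual (inj_eq enum_val_inj).
have [_ P_unit] := mulmx1_unit PW.
have AP : A *m P = P *m D.
  apply/matrixP=> a i; rewrite mul_mx_diag !mxE mulrC.
  have := congr1 (fun u : 'cV_#|I| => u a 0) (eigen (enum_val i)); rewrite !mxE => <-.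
  by apply: eq_bigr => c _; rewrite mxE.
have charP (B : 'M[F]_#|I|) : char_poly_mx B = 'X%:M - map_mx polyC B by [].
have sim : char_poly_mx A *m map_mx polyC P = map_mx polyC P *m char_poly_mx D.
  by rewrite !charP mulmxBl mulmxBr -!map_mxM AP scalar_mxC.
have := congr1 determinant sim; rewrite !det_mulmx mulrC det_map_mx.
move/mulfI; rewrite polyC_eq0 -unitfE -unitmxE => /(_ P_unit).
rewrite -![\det (char_poly_mx _)]/(char_poly _) => ->.
rewrite char_poly_trig ?diag_mx_is_trig //.
rewrite [RHS](reindex _ (onW_bij _ (@enum_val_bij I))) /=.
by apply: eq_bigr => i _; rewrite !mxE eqxx.
Qed.

(** One inequality comes from w, the other from its inverse. *)
Lemma eig_mult_rotate (R : realType) (N n : nat) (S : class_II R N n)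
    (lam : labels N (altitude S)) :
  (1 < N)%N -> in_alcove lam ->
  eig_mult R (gadj S) (rotate_labels lam) = eig_mult R (gadj S) lam.
Proof.
move=> N1 ilam; have N0 := ltnW N1.
have h0 : (0 < altitude S)%N by exact: leq_ltn_trans (ltN_altitude S).
pose w : R[i] := cexpi (- (pi *+ 2 / N%:R)).
have wN : w ^+ N = 1.
  rewrite -[in LHS](card_ord N) -prodr_const prod_cexpi sumr_const card_ord.
  rewrite -[_ *+ N]mulr_natr mulNr mulfVK ?pnatr_eq0 -?lt0n //.
  by rewrite -[LHS]mulr1 -[X in _ * X](cexpi_2pi R) -cexpiD addNr cexpi0.
have rotE p : gamma R p (rotate_labels lam) = w ^+ p * gamma R p lam.
  exact: gamma_rotate.
have w0 p : w ^+ p != 0.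
  rewrite expf_neq0 //; apply/eqP => w0; move/eqP: wN.
  by rewrite w0 expr0n gtn_eqF // eq_sym oner_eq0.
apply/eqP; rewrite eqn_leq; apply/andP; split; last first.
  exact: (eig_mult_twist_le N1 wN (fun p _ => rotE p)).
apply: (@eig_mult_twist_le _ _ _ S _ _ w^-1 N1).
  by rewrite exprVn wN invr1.
by move=> p _; rewrite rotE exprVn mulKf.
Qed.

Lemma card_Exp (R : realType) (N n : nat) (S : class_II R N n) :
  #|Exp S| = n.
Proof.
have := size_basis (psi_basis S).
by rewrite dimvf /dim /= muln1 => /esym.
Qed.

Lemma card_Exp_pred (R : realType) (N n : nat) (S : class_II R N n)
    (P : pred (labels N (altitude S))) :
  #|[set e : Exp S | P (exp_labels e)]|
  = (\sum_(lam : alcove N (altitude S)) eig_mult R (gadj S) (val lam) * P (val lam))%N.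
Proof.
rewrite cardsE -sum1_card.
rewrite (eq_bigl (fun e : Exp S => predT (tag e) && P (val (tag e)))) //.
rewrite -(sig_big_dep _ (fun lam _ => P (val lam)) (fun _ _ => 1%N)) /=.
apply: eq_bigr => lam _; rewrite sum1_card.
by case: (P _); rewrite ?muln1 ?muln0 ?card_ord // eq_card0.
Qed.

(** Each iterate of r is a permutation preserving m, so every k contributes the same
    sum. *)
Lemma sum_iter_invariant (T : finType) (r : T -> T) (m f : T -> nat) (a N : nat) :
  injective r -> (forall x, m (r x) = m x) ->
  (\sum_x m x * \sum_(a <= k < a + N) f (iter k r x) = N * \sum_x m x * f x)%N.
Proof.
move=> r_inj mr; under eq_bigr => x _ do rewrite big_distrr /=.
rewrite exchange_big /=.
have inj k : injective (iter k r) by elim: k => // k IHk x y /r_inj/IHk.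
have mk k x : m (iter k r x) = m x by elim: k => //= k <-.
have shift k : (\sum_x m x * f (iter k r x) = \sum_x m x * f x)%N.
  rewrite [RHS](reindex_inj (inj k)) /=.
  by apply: eq_bigr => x _; rewrite mk.
under eq_bigr => k _ do rewrite shift.
by rewrite sum_nat_const_nat addKn.
Qed.

(** Averaging over the rotation turns the balance along each orbit into an equality
    between the counts on exponents. *)
Lemma card_q_class (R : realType) (N n : nat) (S : class_II R N n) (b : bool) :
  (1 < N)%N ->
  #|[set e : Exp S | q_class b (exp_labels e)]|
  = #|[set e : Exp S | form_sign R b (exp_labels e)]|.
Proof.
move=> N1; have N0 := ltnW N1.
have h0 : (0 < altitude S)%N by exact: leq_ltn_trans (ltN_altitude S).
pose m (lam : alcove N (altitude S)) := eig_mult R (gadj S) (val lam).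
have mr lam : m (rotate_alcove lam) = m lam.
  rewrite /m (val_rotate_alcove lam N1).
  exact: (eig_mult_rotate (S := S) N1 (valP lam)).
have average f := sum_iter_invariant f (2 * N) N (rotate_alcove_inj N1) mr.
apply/eqP; rewrite -(eqn_pmul2l N0) !card_Exp_pred; apply/eqP.
rewrite -(average (fun lam => q_class b (val lam))).
rewrite -(average (fun lam => form_sign R b (val lam))).
by apply: eq_bigr => lam _; congr (_ * _)%N; exact: orbit_balance.
Qed.

(** * Signature *)

Lemma even_interval (R : realType) (m : int) (f : R) : 0 <= f < 1 ->
  (exists p : int, 2 * p%:~R < m%:~R + f < 2 * p%:~R + 1)
  <-> 0 < f /\ (m %% 2)%Z = 0.
Proof.
case/andP=> f0 f1; split=> [[p /andP[lo hi]]|[fpos m2]].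
  have lo' : (2 * p < m + 1)%R.
    by rewrite -(ltr_int R) rmorphM rmorphD /=; lra.
  have hi' : (m < 2 * p + 1)%R.
    by rewrite -(ltr_int R) rmorphD rmorphM /=; lra.
  have mE : m = 2 * p by lia.
  by split; [move: lo; rewrite mE rmorphM /=; lra|lia].
have := divz_eq m 2; rewrite m2 addr0; set p := (m %/ 2)%Z => mE.
by exists p; rewrite mE rmorphM /=; apply/andP; split; lra.
Qed.

(** By [qR_level], q + 1/2 is an integer m plus the fractional part of level / (2 h);
    the three conditions on q bear on the parity of m and on this fractional
    part. *)
Lemma q_interval_class (R : realType) (N h : nat) (lam : labels N h) :
  (0 < N)%N -> (0 < h)%N -> in_alcove lam ->
  [/\ `[< exists p : int, 2 * p%:~R - 1 / 2 < qR R lam < 2 * p%:~R + 1 / 2 >]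
      = q_class (odd N) lam,
      `[< exists p : int, 2 * p%:~R + 1 / 2 < qR R lam < 2 * p%:~R + 3 / 2 >]
      = q_class (~~ odd N) lam &
      `[< exists p : int, qR R lam = p%:~R + 1 / 2 >]
      = (2 * h %| level lam N.-1)%N].
Proof.
move=> N0 h0 ilam.
have H0 : (0 < 2 * h)%N by rewrite muln_gt0.
have := qR_level R N0 h0 ilam; rewrite /q_class.
have := divn_eq (level lam N.-1) (2 * h); have := ltn_pmod (level lam N.-1) H0.
rewrite /dvdn.
set L := level lam N.-1; set d := (L %/ _)%N; set r := (L %% _)%N => rH LE qE.
pose f : R := r%:R / (2 * h)%:R.
have H0' : 0 < (2 * h)%:R :> R by rewrite ltr0n.
have f01 : 0 <= f < 1.
  by rewrite divr_ge0 ?ler0n // ltr_pdivrMr // mul1r ltr_nat.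
have f_gt0 : (0 < f) = (r != 0%N) by rewrite /f pmulr_lgt0 ?invr_gt0 // ltr0n lt0n.
pose m : int := d%:Z - N.-1%:Z - N%:Z.
have {}qE : qR R lam = m%:~R + f - 1 / 2.
  have -> : qR R lam = qR R lam + 1 / 2 - 1 / 2 by ring.
  congr (_ - _); rewrite qE LE natrD natrM /m /f !rmorphB /= !pmulrn; field.
  by rewrite pnatr_eq0 -lt0n.
have parity (b : bool) : ((m - (b : nat)%:Z) %% 2)%Z = 0 <-> odd (d + N.-1) = (odd N (+) b).
  by rewrite /m; case: b; lia.
have q_even := even_interval m f01.
have q_odd := even_interval (m - 1) f01.
have par0 := parity false; have par1 := parity true.
rewrite subr0 addbF in par0; rewrite addbT in par1.
split.
- apply/asboolP/andP => [[p pq]|[rn /eqP par]].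
    have /q_even[fp m2] : exists p : int, 2 * p%:~R < m%:~R + f < 2 * p%:~R + 1.
      by exists p; rewrite qE in pq; lra.
    by rewrite -f_gt0 fp; split=> //; apply/eqP/par0.
  have /q_even[p pq] : 0 < f /\ (m %% 2)%Z = 0 by rewrite f_gt0; split=> //; apply/par0.
  by exists p; rewrite qE; lra.
- apply/asboolP/andP => [[p pq]|[rn /eqP par]].
    have /q_odd[fp m2] :
        exists p : int, 2 * p%:~R < (m - 1)%:~R + f < 2 * p%:~R + 1.
      by exists p; rewrite qE in pq; rewrite rmorphB /=; lra.
    by rewrite -f_gt0 fp; split=> //; apply/eqP/par1.
  have /q_odd[p pq] : 0 < f /\ ((m - 1) %% 2)%Z = 0.
    by rewrite f_gt0; split=> //; apply/par1.
  by exists p; rewrite qE; rewrite rmorphB /= in pq; lra.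
apply/asboolP/eqP => [[p pq]|r0].
  have fE : f = (p + 1 - m)%:~R.
    by rewrite rmorphB rmorphD /=; rewrite qE in pq; lra.
  apply/eqP; rewrite -[_ == _]negbK -f_gt0 -leNgt.
  have : (p + 1 - m < 1)%R by rewrite -(ltr_int R) -fE; case/andP: f01.
  by rewrite fE lerz0; lia.
have f0 : f = 0 by rewrite /f r0 mul0r.
by exists (m - 1); rewrite qE f0 [in RHS]rmorphB /=; lra.
Qed.

Lemma intersection_form_eigen (R : realType) (N n : nat) (S : class_II R N n)
    (e : Exp S) : (1 < N)%N ->
  map_mx (real_complex R) (intersection_form S) *m psi e
  = (form_eigenvalue R (exp_labels e))%:C%C *: psi e.
Proof.
move=> N1; have N0 := ltnW N1.
have h0 : (0 < altitude S)%N by exact: leq_ltn_trans (ltN_altitude S).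
have -> : map_mx (real_complex R) (intersection_form S)
    = 2%:M + \sum_(1 <= p < N) adj_mx R[i] (gadj S p).
  apply/matrixP => a b; rewrite !mxE summxE rmorphD rmorphM /= rmorph_sum.
  congr (_ + _).
    by rewrite !rmorph_nat mulr_natr.
  by apply: eq_bigr => p _; rewrite mxE rmorph_nat.
rewrite mulmxDl mul_scalar_mx mulmx_suml.
rewrite -(sum_gamma R N1 h0 (valP (tag e))) [RHS]scalerDl scaler_suml; congr (_ + _).
apply: eq_big_nat => p pN; exact: psi_eigen.
Qed.

Lemma char_poly_intersection_form (R : realType) (N n : nat) (S : class_II R N n) :
  (1 < N)%N ->
  char_poly (intersection_form S)
  = \prod_(e : Exp S) ('X - (form_eigenvalue R (exp_labels e))%:P).
Proof.
move=> N1; apply: (map_poly_inj (real_complex R)); rewrite map_char_poly rmorph_prod /=.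
rewrite (char_poly_eigenbasis (card_Exp S) (psi_orthonormal (c := S))
  (fun e => intersection_form_eigen e N1)).
by apply: eq_bigr => e _; rewrite rmorphB /= map_polyX map_polyC.
Qed.

Lemma card_trichotomy (T : finType) (P Q Z : pred T) :
  (forall e, P e + Q e + Z e = 1)%N ->
  (#|[set e | P e]| + #|[set e | Q e]| + #|[set e | Z e]| = #|T|)%N.
Proof.
move=> PQZ; rewrite !cardsE -!sum1_card !(big_mkcond (fun e => e \in _)).
rewrite -!big_split; apply: eq_bigr => e _.
by rewrite -[RHS](PQZ e) !unfold_in; case: (P e); case: (Q e); case: (Z e).
Qed.

Theorem corollary1 (R : realType) (N n : nat) (S : class_II R N n)
    (hN : (2 <= N)%N) :
  let q (e : Exp S) : R := qR R (exp_labels e) in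
  let x := #|[set e : Exp S |
      `[< exists p : int, 2 * p%:~R - 1 / 2 < q e < 2 * p%:~R + 1 / 2 >]]| in
  let y := #|[set e : Exp S |
      `[< exists p : int, 2 * p%:~R + 1 / 2 < q e < 2 * p%:~R + 3 / 2 >]]| in
  let z := #|[set e : Exp S |
      `[< exists p : int, q e = p%:~R + 1 / 2 >]]| in
  has_signature (intersection_form S) x y z /\ (x + y + z)%N = n.
Proof.
move=> q x y z; have N0 := ltnW hN.
have h0 : (0 < altitude S)%N by exact: leq_ltn_trans (ltN_altitude S).
have qC (e : Exp S) := q_interval_class R N0 h0 (valP (tag e)).
pose F (e : Exp S) := form_eigenvalue R (exp_labels e).
have xE : x = #|[set e : Exp S | q_class (odd N) (exp_labels e)]|.
  by congr #|pred_of_set _|; apply/setP => e; rewrite !inE; case: (qC e).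
have yE : y = #|[set e : Exp S | q_class (~~ odd N) (exp_labels e)]|.
  by congr #|pred_of_set _|; apply/setP => e; rewrite !inE; case: (qC e).
have zE : z = #|[set e : Exp S | (2 * altitude S %| level (exp_labels e) N.-1)%N]|.
  by congr #|pred_of_set _|; apply/setP => e; rewrite !inE; case: (qC e).
have countE (P : pred R) : count P [seq F e | e <- enum (Exp S)] = #|[set e | P (F e)]|.
  by rewrite count_map enumT cardsE cardE size_filter.
have xyz : (x + y + z = n)%N.
  rewrite -[RHS](card_Exp S) xE yE zE; apply: card_trichotomy => e.
  by rewrite /q_class; case: (_ %| _)%N; case: (odd N); case: (odd _).
have posE : #|[set e | 0 < F e]| = x.
  rewrite xE (card_q_class S _ hN); congr #|pred_of_set _|; apply/setP => e.
  by rewrite !inE /form_sign eqxx.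
have negE : #|[set e | F e < 0]| = y.
  rewrite yE (card_q_class S _ hN); congr #|pred_of_set _|; apply/setP => e.
  by rewrite !inE /form_sign; case: (odd N).
have Fxyz : (#|[set e | (0 < F e)%R]| + #|[set e | (F e < 0)%R]|
    + #|[set e | F e == 0%R]| = n)%N.
  rewrite -[RHS](card_Exp S); apply: card_trichotomy => e.
  by case: (ltgtP (F e) 0).
split=> //; exists [seq F e | e <- enum (Exp S)]; rewrite !countE; split=> //.
  by rewrite char_poly_intersection_form // big_map big_enum.
by move: Fxyz; rewrite posE negE -[RHS]xyz => /addnI.
Qed.
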